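(* There are infinitely many positive integers $k$ such that there exists a finite graph $\Gamma_k$ for which there are exactly $k$ isomorphism classes of finite groups $G$ satisfying $\Delta_G^c \cong \Gamma_k$. Indeed, this is possible with $\Gamma_k$ a complete graph: there are infinitely many positive integers $k$ for which such a $\Gamma_k$ exists that is complete.
   Context: For a finite group $G$, the co-intersection graph $\Delta_G^c$ is the simple graph whose vertices are the nontrivial proper subgroups of $G$, two distinct subgroups being adjacent if and only if they intersect trivially. *)

(* Defs.v *)
From mathcomp Require Import all_boot all_fingroup.

Set Implicit Arguments.
Unset Strict Implicit.
Unset Printing Implicit Defensive.

Local Open Scope group_scope.

(* The vertex set may be empty: the co-intersection graph of a group that is
   trivial or of prime order has no vertices. *)
Record finGraph := FinGraph {
  vertex :> finType;
  adj : rel vertex;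
  adj_sym : symmetric adj;
  adj_irr : irreflexive adj
}.

Definition graph_iso (A B : finGraph) : Prop :=
  exists2 f : A -> B, bijective f & forall x y : A, adj (f x) (f y) = adj x y.

Definition complete_graph (A : finGraph) : Prop :=
  forall x y : A, x != y -> adj x y.

Section CoIntersectionGraph.
Variables (gT : finGroupType) (G : {group gT}).

Definition ntproper_subgroup : Type :=
  {H : {group gT} | (H :!=: 1) && (H \proper G)}.

Definition coint_adj : rel ntproper_subgroup :=
  fun H K => (H != K) && (val H :&: val K == 1).

Fact coint_adj_sym : symmetric coint_adj.
Proof. by move=> H K; rewrite /coint_adj eq_sym setIC. Qed.

Fact coint_adj_irr : irreflexive coint_adj.
Proof. by move=> H; rewrite /coint_adj eqxx. Qed.

Definition coint_graph : finGraph := FinGraph coint_adj_sym coint_adj_irr.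

End CoIntersectionGraph.

(* A finite group is represented by a [finGroupType], i.e., by the full group
   [set: gT]. *)
Definition group_iso (gT hT : finGroupType) : Prop :=
  [set: gT] \isog [set: hT].

(* Exactly k isomorphism classes of finite groups satisfy P: F lists one
   representative of each class, without repetition. *)
Definition exactly_iso_classes (k : nat) (P : finGroupType -> Prop) : Prop :=
  exists F : 'I_k -> finGroupType,
    [/\ forall i, P (F i),
        forall i j, group_iso (F i) (F j) -> i = j
      & forall gT, P gT -> exists i, group_iso gT (F i)].

Definition iso_classes_of_graph (k : nat) (Gamma : finGraph) : Prop :=
  exactly_iso_classes k
    (fun gT => graph_iso (coint_graph [set: gT]%G) Gamma).

(* Main.v *)
(* If the co-intersection graph of G is complete, every nontrivial proper
   subgroup of G has prime order; one of them is normal, so |G| = p r with p, r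
   prime, and if G is not cyclic then counting nonidentity elements gives p + 1
   vertices, where p is the order of the normal subgroup. So for q prime the
   groups with graph K_(q+1) are the elementary abelian group of order q^2 and,
   for each prime r dividing q - 1, the nonabelian group of order q r: there are
   1 + omega(q - 1) of them. This number is unbounded because, by the cyclotomic
   case of Dirichlet's theorem, some prime q is 1 modulo any given m. *)
Require Import Defs.
From mathcomp Require Import all_boot all_order all_algebra all_fingroup.
From mathcomp Require Import all_solvable all_field zify.
Set Implicit Arguments.
Unset Strict Implicit.
Unset Printing Implicit Defensive.
Import GRing.Theory.

(** * Primes congruent to 1 modulo m *)

Section Cyclo.
Local Open Scope ring_scope.

Lemma prod_map_Cyclotomic (R : nzRingType) (n : nat) : (0 < n)%N ->
  \prod_(d <- divisors n) map_poly intr 'Phi_d = 'X^n - 1 :> {poly R}.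
Proof.
move=> n_gt0; rewrite -rmorph_prod prod_Cyclotomic //.
by rewrite rmorphB rmorph1 /= map_polyXn.
Qed.

Lemma root_Cyclotomic_unity (F : fieldType) (n : nat) (x : F) :
  (0 < n)%N -> root (map_poly intr 'Phi_n) x -> x ^+ n = 1.
Proof.
move=> n_gt0 /rootP rx; have n_div : n \in divisors n by rewrite -dvdn_divisors.
apply/eqP; rewrite -subr_eq0 -[_ - 1](_ : ('X^n - 1).[x] = _); last first.
  by rewrite !hornerE.
by rewrite -prod_map_Cyclotomic // (big_rem _ n_div) /= hornerM rx mul0r.
Qed.

(** If the order [d] of [x] were a proper divisor of [n], then [x] would be a root of both ['Phi_n]
    and some ['Phi_e] with [e] dividing [d], hence a double root of ['X^n - 1]. That polynomial is
    separable because [n] is nonzero in [F]. *)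
Lemma root_Cyclotomic_prim (F : fieldType) (n : nat) (x : F) :
  n%:R != 0 :> F -> root (map_poly intr 'Phi_n) x -> n.-primitive_root x.
Proof.
move=> nF rx.
have n0 : (0 < n)%N by case: n nF {rx} => //; rewrite eqxx.
have n_div : n \in divisors n by rewrite -dvdn_divisors.
have xn1 := root_Cyclotomic_unity n0 rx.
have [d prd dn] := prim_order_exists n0 xn1.
case: (eqVneq d n) => [<- //|neq_dn].
have d0 : (0 < d)%N := prim_order_gt0 prd.
have : root ('X^d - 1) x.
  by rewrite /root !hornerE (prim_expr_order prd) subrr.
rewrite -prod_map_Cyclotomic // /root horner_prod prodf_seq_eq0 => /hasP[e e_d /= re].
have ed : (e %| d)%N by rewrite dvdn_divisors.
have neq_en : e != n.
  apply: contraNneq neq_dn => een; rewrite eqn_dvd dn.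
  by rewrite -een ed.
have e_rem : e \in rem n (divisors n).
  rewrite mem_rem_uniq ?divisors_uniq // inE neq_en -dvdn_divisors //.
  exact: dvdn_trans ed dn.
have dvd2 : ('X - x%:P) ^+ 2 %| 'X^n - 1.
  rewrite -prod_map_Cyclotomic // (big_rem _ n_div) (big_rem _ e_rem) /= mulrA expr2.
  by rewrite dvdp_mulr // dvdp_mul // dvdp_XsubCl.
have /separable_polyP[/(_ ('X - x%:P) ('X - x%:P))] := separable_Xn_sub_1 nF.
by rewrite -expr2 => /(_ dvd2); rewrite coprimepp size_XsubC.
Qed.

Lemma Fp_expf_pred (q : nat) (x : 'F_q) : prime q -> x != 0 -> x ^+ q.-1 = 1.
Proof.
move=> q_pr nzx; have := expf_card x; rewrite card_Fp //.
rewrite -[X in _ ^+ X](prednK (prime_gt0 q_pr)) exprS.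
by rewrite -{3}[x]mulr1 => /(mulfI nzx).
Qed.

(* Take a prime divisor q of Phi_m(a) for a multiple a of m such that
   Phi_m(a) is not 0, 1 or -1: since q divides a^m - 1 it does not divide m,
   hence a has order exactly m modulo q. *)
Lemma prime_1_mod (m : nat) : (0 < m)%N -> exists2 q, prime q & (m %| q.-1)%N.
Proof.
move=> m_gt0.
have totm : (1 < size 'Phi_m)%N by rewrite size_Cyclotomic ltnS totient_gt0.
have nzD c : 'Phi_m - c%:P != 0 :> {poly int}.
  rewrite subr_eq0; apply: contraTneq totm => ->.
  by rewrite -leqNgt size_polyC leq_b1.
pose p : {poly int} := ('Phi_m - 0%:P) * ('Phi_m - 1%:P) * ('Phi_m - (-1)%:P).
have pn0 : p != 0 by rewrite !mulf_neq0 ?nzD.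
pose rs : seq int := [seq (m * i)%:Z | i <- iota 0 (size p)].
(* A nonzero polynomial has fewer roots than its size, so one of these [size p] distinct multiples
   of [m] is not a root of [p]. *)
have /allPn[a /mapP[i _ ai] pa] : ~~ all (root p) rs.
  apply: contraTN isT => all_rs; have := max_poly_roots pn0 all_rs.
  rewrite /rs size_map size_iota ltnn; apply.
  rewrite map_inj_uniq ?iota_uniq // => j k [] /eqP.
  by rewrite eqn_pmul2l // => /eqP.
have [v1 v0] : `|('Phi_m).[a]|%N != 1%N /\ `|('Phi_m).[a]|%N != 0%N.
  move: pa; rewrite /root !hornerE !mulf_eq0 !negb_or opprK addr_eq0.
  by case: (_.[a]) => [[|[|n]]|[|n]].
set N := `|_|%N in v1 v0; set q := pdiv N.
have q_pr : prime q by rewrite pdiv_prime // ltn_neqAle eq_sym v1 lt0n.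
exists q => //.
have rootq : root (map_poly intr 'Phi_m) (a%:~R : 'F_q).
  rewrite /root horner_map /= -(dvdz_pcharf (pchar_Fp q_pr)).
  exact: pdiv_dvd.
have am1 := root_Cyclotomic_unity m_gt0 rootq.
have mF : m%:R != 0 :> 'F_q.
  apply: contraTneq isT => m0; move/eqP: am1.
  by rewrite ai -pmulrn natrM m0 mul0r expr0n gtn_eqF // eq_sym oner_eq0.
have prim := root_Cyclotomic_prim mF rootq.
rewrite (prim_order_dvd prim); apply/eqP.
apply: Fp_expf_pred => //; apply: contra_eq_neq am1 => ->.
by rewrite expr0n gtn_eqF // eq_sym oner_eq0.
Qed.
End Cyclo.

(** Multiplying [m] by a prime larger than [m] adds a new prime divisor. *)
Lemma ex_many_primes (n : nat) : exists2 m, 0 < m & n <= size (primes m).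
Proof.
elim: n => [|n [m m_gt0 le_nm]]; first by exists 1.
have [p lt_mp p_pr] := prime_above m.
exists (p * m); first by rewrite muln_gt0 prime_gt0.
apply: leq_ltn_trans le_nm _.
have pm : p \notin primes m.
  rewrite mem_primes p_pr m_gt0 /=; apply: contraTN lt_mp => /dvdn_leq.
  by rewrite m_gt0 -leqNgt => ->.
apply: (@uniq_leq_size _ (p :: primes m)) => [|r]; first by rewrite /= pm primes_uniq.
by rewrite inE primesM ?(primes_prime p_pr) ?mem_seq1 ?(prime_gt0 p_pr).
Qed.

Lemma ex_prime_pred_many_primes (n : nat) :
  exists2 q, prime q & n <= size (primes q.-1).
Proof.
have [m m_gt0 le_nm] := ex_many_primes n.
have [q q_pr dvd_mq] := prime_1_mod m_gt0; exists q => //.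
apply: leq_trans le_nm _; apply: uniq_leq_size => [|p]; first exact: primes_uniq.
rewrite !mem_primes -subn1 subn_gt0 prime_gt1 // subn1 => /and3P[-> _ dvd_pm].
exact: dvdn_trans dvd_pm dvd_mq.
Qed.

(** * Finite groups with a complete co-intersection graph *)

Local Open Scope group_scope.

Lemma proper_dvdn_mul_primes (d p r : nat) : prime p -> prime r ->
  d %| p * r -> d != 1%N -> d != (p * r)%N -> d \in [:: p; r].
Proof.
move=> p_pr r_pr dvd_d d_neq1 d_neqpr; rewrite !inE.
have [dvd_pd|] := boolP (p %| d).
  have /dvdnP[e def_d] := dvd_pd; have /primeP[_ dvd_r] := r_pr.
  move: dvd_d d_neqpr; rewrite def_d mulnC eqn_pmul2l ?dvdn_pmul2l ?prime_gt0 //.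
  by move=> /dvd_r/orP[/eqP-> | /eqP->]; rewrite ?muln1 !eqxx.
rewrite -prime_coprime // coprime_sym => co_dp.
have /primeP[_ dvd_r] := r_pr; move: dvd_d; rewrite Gauss_dvdr // => /dvd_r.
by rewrite (negPf d_neq1) /= => ->; rewrite orbT.
Qed.

Section Coint.
Variables (gT : finGroupType) (G : {group gT}).

Definition proper_subgroups_prime :=
  forall H : {group gT}, H :!=: 1 -> H \proper G -> prime #|H|.

Lemma prime_order_subgroup_eq (H K : {group gT}) :
  prime #|H| -> K :!=: 1 -> K \subset H -> K = H.
Proof.
move=> H_pr ntK sKH; apply/eqP; rewrite -val_eqE /= eqEcard sKH.
have /primeP[_ /(_ _ (cardSg sKH))] := H_pr.
by rewrite trivg_card1 in ntK; rewrite /= (negPf ntK) => /eqP->.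
Qed.

(** By Cauchy, [H] contains a subgroup of prime order; the two meet nontrivially, so completeness
    forces them to coincide. Conversely, distinct subgroups of prime order meet trivially. *)
Lemma complete_coint_graphP :
  complete_graph (coint_graph G) <-> proper_subgroups_prime.
Proof.
split=> [complG H ntH prH | prG [H vH] [K vK] neqHK].
  have pr_p : prime (pdiv #|H|) by rewrite pdiv_prime ?cardG_gt1.
  have [x Hx ox] := Cauchy pr_p (pdiv_dvd _).
  have sxH : <[x]> \subset H by rewrite cycle_subG.
  have ntx : <[x]> != 1 by rewrite cycle_eq1 -order_gt1 ox prime_gt1.
  have prx : <[x]> \proper G := sub_proper_trans sxH prH.
  case: (eqVneq H <[x]>%G) => [-> | neqH]; first by rewrite -orderE ox.
  pose u : ntproper_subgroup G := exist _ H (introT andP (conj ntH prH)).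
  pose v : ntproper_subgroup G := exist _ <[x]>%G (introT andP (conj ntx prx)).
  have /andP[_ /=] : adj (u : coint_graph G) v by apply: complG.
  by rewrite (setIidPr sxH) (negPf ntx).
have [/andP[ntH prH] /andP[ntK prK]] := (vH, vK).
rewrite /= /coint_adj neqHK /=; apply/eqP/prime_TIg; first exact: prG.
apply: contra neqHK => sHK; rewrite -val_eqE /=; apply/eqP.
by apply: prime_order_subgroup_eq; rewrite ?prG.
Qed.

(** The normaliser of a non-normal [H] is proper, so it has prime order and equals [H]. A
    nonidentity element common to [H] and [H :^ g] generates both, which puts [g] in that
    normaliser. *)
Lemma prime_subgroup_TI_self_normalising (H : {group gT}) :
    proper_subgroups_prime -> H :!=: 1 -> H \proper G -> ~~ (H <| G) ->
  normedTI H^# G H.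
Proof.
move=> prG ntH ltHG nnH; have sHG := proper_sub ltHG.
have H_pr := prG H ntH ltHG.
have defN : 'N_G(H) = H.
  have sHN : H \subset 'N_G(H) by rewrite subsetI sHG normG.
  have ltNG : 'N_G(H) \proper G.
    rewrite properE subsetIl subsetI subxx /=.
    by apply: contra nnH => nHG; rewrite /normal sHG.
  apply/esym/(congr1 (@gval _))/(@prime_order_subgroup_eq 'N_G(H)) => //.
  exact: prG (subG1_contra sHN ntH) ltNG.
apply/normedTI_P; split; first by rewrite setD_eq0 subG1.
  by rewrite subsetI sHG normD1 normG.
move=> g Gg; rewrite -setI_eq0 => /set0Pn[x].
rewrite conjD1g => /setIP[/setD1P[ntx Hx] /setD1P[_ Hgx]].
rewrite -defN inE Gg /= inE; apply/eqP.
have ntc : <[x]> != 1 by rewrite cycle_eq1.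
have xH : <[x]>%G = H by apply: prime_order_subgroup_eq; rewrite ?cycle_subG.
have xHg : <[x]>%G = (H :^ g)%G.
  by apply: prime_order_subgroup_eq; rewrite /= ?cardJg ?cycle_subG.
by rewrite -[H :^ g]/(gval (H :^ g)%G) -xHg xH subxx.
Qed.

(* If no such subgroup were normal, the nonidentity elements of the conjugates
   of a single one would fill at least half of G; two non-conjugate ones
   would then leave no room for the identity. *)
Lemma normal_proper_subgroup_exists :
    proper_subgroups_prime -> G :!=: 1 -> ~~ prime #|G| ->
  exists2 H : {group gT}, H <| G & (H :!=: 1) && (H \proper G).
Proof.
move=> prG ntG nprG.
case: (pickP [pred H : {group gT} | [&& H <| G, H :!=: 1 & H \proper G]]).
  by move=> H /and3P[nHG ntH ltHG]; exists H; rewrite ?ntH.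
move=> nonormal.
have nnormal (H : {group gT}) : H :!=: 1 -> H \proper G -> ~~ (H <| G).
  by move=> ntH ltHG; have /= := nonormal H; rewrite ntH ltHG !andbT => ->.
(* If [x] generated [G], then [G] would be abelian and a subgroup of prime order, proper since
   [#|G|] is not prime, would be normal. *)
have prcycle x : x \in G -> x != 1 -> (<[x]>%G :!=: 1) && (<[x]> \proper G).
  move=> Gx ntx; rewrite cycle_eq1 ntx /= properEneq cycle_subG Gx andbT.
  apply: contra nprG => /eqP defG.
  have pr_p : prime (pdiv #|G|) by rewrite pdiv_prime ?cardG_gt1.
  have [y Gy oy] := Cauchy pr_p (pdiv_dvd _).
  have syG : <[y]> \subset G by rewrite cycle_subG.
  have nty : <[y]> != 1 by rewrite cycle_eq1 -order_gt1 oy prime_gt1.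
  have [->|] := eqVneq (G : {set gT}) <[y]>; first by rewrite -orderE oy.
  rewrite eq_sym => neyG.
  have ltyG : <[y]> \proper G by rewrite properEneq neyG.
  have abG : abelian G by rewrite -defG cycle_abelian.
  by have := nnormal <[y]>%G nty ltyG; rewrite -sub_abelian_normal /= ?syG.
pose cs (H : {group gT}) := class_support H^# G.
(* The class support has [(#|H| - 1) * #|G : H|] elements, that is [#|G| - #|G : H|], and
   [#|H| >= 2]. *)
have half (H : {group gT}) : H :!=: 1 -> H \proper G ->
    #|cs H| + #|G : H| = #|G| /\ #|G| <= 2 * #|cs H|.
  move=> ntH ltHG; have nnH := nnormal H ntH ltHG.
  rewrite (card_support_normedTI (prime_subgroup_TI_self_normalising prG ntH ltHG nnH)).
  have := Lagrange (proper_sub ltHG); have := cardsD1 1 H; rewrite group1.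
  have := cardG_gt1 H; rewrite ntH; move: #|_ : _| => i.
  move=> /[swap] /[dup] oH -> h_gt1 <-; rewrite add1n mulSn addnC; split=> //.
  have : i <= #|H^#| * i by rewrite leq_pmull // -ltnS -add1n.
  by rewrite mul2n -addnn leq_add2r.
have csG (M : {group gT}) : M \subset G -> cs M \subset G^#.
  move=> sMG; apply/subsetP=> _ /imset2P[h g /setD1P[nth Hh] Gg ->].
  by rewrite !inE conjg_eq1 nth groupJ // (subsetP sMG).
have /trivgPn[x0 Gx0 ntx0] := ntG.
have /andP[ntH ltHG] := prcycle x0 Gx0 ntx0; set H := <[x0]>%G in ntH ltHG.
have [cardH halfH] := half H ntH ltHG.
(* The conjugates of [H] miss [#|G : H| - 1 > 0] nonidentity elements. *)
have [x /setD1P[ntx Gx] csx] : exists2 x, x \in G^# & x \notin cs H.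
  apply/subsetPn; apply: contraL (ltHG) => /subset_leq_card le_cs.
  have : #|G : H| <= 1.
    by rewrite -(leq_add2l #|cs H|) cardH (cardsD1 1 G) group1 addnC leq_add2r.
  by move=> le1; rewrite properE -(indexg_eq1 G) eqn_leq le1 indexg_gt0 andbF.
have /andP[ntK ltKG] := prcycle x Gx ntx; set K := <[x]>%G in ntK ltKG.
have [_ halfK] := half K ntK ltKG.
(* A common element would give a generator [k] of [K] inside a conjugate of [H]; that conjugate
   would then contain [x], against the choice of [x]. *)
have dis : cs H :&: cs K = set0.
  apply/setP=> z; rewrite !inE; apply: contraNF csx => /andP[].
  case/imset2P=> h a /setD1P[nth Hh] Ga -> /imset2P[k b /setD1P[ntk Kk] Gb hk].
  have K_pr := prG K ntK ltKG.
  have defK : <[k]>%G = K.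
    by apply: prime_order_subgroup_eq; rewrite ?cycle_subG ?cycle_eq1.
  have kH : k \in H :^ (a * b^-1).
    by rewrite -[k](conjgK b) -hk -conjgM memJ_conjg.
  have xH : x \in H :^ (a * b^-1).
    apply: subsetP (cycle_id x); rewrite -[<[x]>]/(gval K) -defK /=.
    by rewrite cycle_subG.
  rewrite -(conjgKV (a * b^-1) x) memJ_class_support ?groupM ?groupV //.
  by rewrite !inE -mem_conjg xH conjg_eq1 ntx.
have /subset_leq_card : cs H :|: cs K \subset G^#.
  by rewrite subUset !csG ?proper_sub.
rewrite cardsU dis cards0 subn0 => le_cs; exfalso.
have := cardsD1 1 G; rewrite group1 add1n => oG.
move: halfH halfK le_cs; rewrite oG; move: #|G^#| #|cs H| #|cs K| => a b c; lia.
Qed.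

(** A subgroup of prime order in [G / H] lifts to some [L] strictly containing [H]. If [L] were
    proper it would have prime order, forcing [L = H]; so [L = G]. *)
Lemma prime_index_of_prime_subgroup (H : {group gT}) :
    proper_subgroups_prime -> H <| G -> H :!=: 1 -> H \proper G ->
  prime #|G : H|.
Proof.
move=> prG nHG ntH ltHG; have [sHG nH] := andP nHG.
have nt_idx : 1 < #|G / H|.
  by rewrite cardG_gt1 -subG1 quotient_sub1 // (proper_subn ltHG).
have r_pr := pdiv_prime nt_idx; rewrite -card_quotient //.
have [y Gy oy] := Cauchy r_pr (pdiv_dvd _).
have nty : <[y]> != 1 by rewrite cycle_eq1 -order_gt1 oy prime_gt1.
have [|L defL sHL sLG] := inv_quotientS nHG (_ : <[y]>%G \subset G / H).
  by rewrite cycle_subG.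
have [eqLG | neqLG] := eqVneq L G; first by rewrite -eqLG -defL -orderE oy.
have ltLG : L \proper G by rewrite properEneq sLG andbT.
have ntL : L :!=: 1 := subG1_contra sHL ntH.
have eqHL := prime_order_subgroup_eq (prG L ntL ltLG) ntH sHL.
by case/eqP: nty; rewrite /= in defL; rewrite defL -eqHL trivg_quotient.
Qed.

(** Since [G] is not cyclic, mapping [x] to [<[x]>] partitions [G^#] by the proper nontrivial
    subgroups, and every nonidentity element of a group of prime order generates it. *)
Lemma sum_card_proper_subgroups :
    proper_subgroups_prime -> ~~ cyclic G ->
  \sum_(H : {group gT} | (H :!=: 1) && (H \proper G)) #|H|.-1 = #|G|.-1.
Proof.
move=> prG ncG; have := cardsD1 1 G; rewrite group1 add1n => -> /=.
rewrite -sum1_card (partition_big (fun x => <[x]>%G)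
  (fun H : {group gT} => (H :!=: 1) && (H \proper G))) /=; last first.
  move=> x /setD1P[ntx Gx]; rewrite cycle_eq1 ntx properEneq cycle_subG Gx andbT.
  by apply: contra ncG => /eqP <-; apply: cycle_cyclic.
apply: eq_bigr => H /andP[ntH ltHG]; have H_pr := prG H ntH ltHG.
have := cardsD1 1 H; rewrite group1 add1n => -> /=; rewrite -sum1_card.
apply: eq_bigl => x; rewrite !inE; apply/idP/idP.
  case/andP=> ntx Hx; rewrite ntx (subsetP (proper_sub ltHG)) //=.
  by apply/eqP/prime_order_subgroup_eq; rewrite ?cycle_subG ?cycle_eq1.
by case/andP=> /andP[-> _] /eqP <-; apply: cycle_id.
Qed.

(** Every vertex other than [H] has order [r], so with [n] such vertices counting nonidentity
    elements gives [(#|H| - 1) + n * (r - 1) = #|H| * r - 1], whence [n = #|H|]. *)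
Lemma card_coint_graph_noncyclic (H : {group gT}) (r : nat) :
    prime #|H| -> prime r -> H <| G -> #|G| = (#|H| * r)%N -> ~~ cyclic G ->
  proper_subgroups_prime /\ #|coint_graph G| = #|H|.+1.
Proof.
move=> H_pr r_pr /andP[sHG nHG] oG ncG.
have ntH : H :!=: 1 by rewrite -cardG_gt1 prime_gt1.
have ltHG : H \proper G.
  by rewrite properEcard sHG oG ltn_Pmulr ?prime_gt1 ?prime_gt0.
have oK (K : {group gT}) : K :!=: 1 -> K \proper G -> K != H -> #|K| = r.
  move=> ntK ltKG neqKH.
  have tiHK : H :&: K = 1.
    apply: prime_TIg => //; apply: contra neqKH => sHK.
    (* A subgroup containing [H] has index 1 or [r] over [H], so it is [H] or [G]. *)
    have : #|K : H| %| r.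
      by rewrite -(dvdn_pmul2l (cardG_gt0 H)) Lagrange // -oG cardSg ?proper_sub.
    have /primeP[_ dvd_r] := r_pr => /dvd_r/orP[|/eqP idxK].
      by rewrite indexg_eq1 => sKH; rewrite -val_eqE eqEsubset /= sHK sKH.
    by have := proper_card ltKG; rewrite oG -idxK Lagrange // ltnn.
  have : #|H| * #|K| %| #|G|.
    rewrite -TI_cardMg // -norm_joinEr ?cardSg //.
      by rewrite join_subG sHG proper_sub.
    by apply: subset_trans nHG; apply: proper_sub.
  rewrite oG dvdn_pmul2l ?prime_gt0 //.
  have /primeP[_ dvd_r] := r_pr => /dvd_r; rewrite -trivg_card1 (negPf ntK) /=.
  by move/eqP.
have prG : proper_subgroups_prime.
  by move=> K ntK ltKG; have [-> //|/oK->] := eqVneq K H.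
split=> //; have := sum_card_proper_subgroups prG ncG.
rewrite (bigD1 H) ?ntH //= (eq_bigr (fun=> r.-1)); last first.
  by move=> K /andP[/andP[ntK ltKG] neqKH]; rewrite oK.
rewrite sum_nat_const oG; set n := #|_| => sum_n.
have -> : #|coint_graph G| = n.+1.
  have -> : #|coint_graph G| =
      #|[pred K : {group gT} | (K :!=: 1) && (K \proper G)]| by apply: card_sig.
  rewrite (cardD1 H) unfold_in /= ntH ltHG add1n; congr _.+1.
  by apply: eq_card => K; rewrite !unfold_in /= andbC.
congr _.+1; case: r r_pr {oG oK} sum_n => [|[|r]] // _.
case: #|H| (prime_gt0 H_pr) => // h _.
have -> : (h.+1 * r.+2).-1 = h + h.+1 * r.+1 by lia.
move=> /addnI /eqP.
by rewrite eqn_pmul2r // => /eqP.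
Qed.

(** A cyclic group has at most one subgroup of each order, and only the orders [p] and [r] are
    possible here. *)
Lemma card_coint_graph_cyclic (p r : nat) :
  prime p -> prime r -> #|G| = (p * r)%N -> cyclic G -> #|coint_graph G| <= 2.
Proof.
move=> p_pr r_pr oG cG.
pose f (K : coint_graph G) := #|val K|.
have f_inj : injective f.
  move=> [K vK] [L vL] eqf; do 2!apply: val_inj; apply/eqP => /=.
  have [/andP[_ ltK] /andP[_ ltL]] := (vK, vL).
  by rewrite (eq_subG_cyclic cG) ?proper_sub //; apply/eqP.
rewrite cardE -(size_map f); apply: (@uniq_leq_size _ _ [:: p; r]).
  by rewrite map_inj_uniq ?enum_uniq.
move=> _ /mapP[[K vK] _ ->]; rewrite /f /=; have /andP[ntK ltK] := vK.
apply: proper_dvdn_mul_primes => //; rewrite -?oG ?cardSg ?proper_sub //.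
  by rewrite -trivg_card1.
by rewrite neq_ltn proper_card.
Qed.

(** The bound on the number of vertices rules out cyclic groups; it also provides a vertex, so [G]
    is neither trivial nor of prime order. *)
Lemma complete_coint_graph_structure :
    complete_graph (coint_graph G) -> 2 < #|coint_graph G| ->
  exists2 H : {group gT}, H <| G &
    [/\ prime #|H|, prime #|G : H|, ~~ cyclic G & #|coint_graph G| = #|H|.+1].
Proof.
move=> /complete_coint_graphP prG gt2.
have [[K vK] _] : exists K, K \in coint_graph G.
  by apply/card_gt0P; apply: leq_trans gt2.
have /andP[ntK ltKG] := vK.
have ntG : G :!=: 1 := subG1_contra (proper_sub ltKG) ntK.
have nprG : ~~ prime #|G|.
  apply/negP => G_pr.
  have eqKG := prime_order_subgroup_eq G_pr ntK (proper_sub ltKG).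
  by move: ltKG; rewrite eqKG properxx.
have [H nHG /andP[ntH ltHG]] := normal_proper_subgroup_exists prG ntG nprG.
have H_pr := prG H ntH ltHG.
have r_pr := prime_index_of_prime_subgroup prG nHG ntH ltHG.
have oG := esym (Lagrange (normal_sub nHG)).
have ncG : ~~ cyclic G.
  by apply: contraL gt2 => cG; rewrite -leqNgt (card_coint_graph_cyclic _ _ oG).
by exists H => //; have [_] := card_coint_graph_noncyclic H_pr r_pr nHG oG ncG.
Qed.

End Coint.

(** * Noncyclic groups of order q r *)

Lemma prime_primitive_root (F : fieldType) (r : nat) (x : F) :
  prime r -> (x ^+ r = 1)%R -> x != 1%R -> (r.-primitive_root x)%R.
Proof.
move=> r_pr xr1 x_neq1; have [d prim_x dvd_dr] := prim_order_exists (prime_gt0 r_pr) xr1.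
have /primeP[_ /(_ _ dvd_dr)/orP[/eqP d1|/eqP <- //]] := r_pr.
by case/eqP: x_neq1; have := prim_expr_order prim_x; rewrite d1 expr1.
Qed.

Lemma eq_natr_Fp (q m n : nat) : prime q ->
  (m%:R == n%:R :> 'F_q)%R = (m == n %[mod q]).
Proof.
move=> q_pr; apply/eqP/eqP => [/(congr1 val) /= | eq_mn].
  by rewrite !val_Fp_nat.
by apply: val_inj; rewrite /= !val_Fp_nat.
Qed.

Lemma Fp_primitive_root_exists (q : nat) : prime q ->
  exists w : 'F_q, (q.-1.-primitive_root w)%R.
Proof.
move=> q_pr; have q1_gt0 : 0 < q.-1 by rewrite -subn1 subn_gt0 prime_gt1.
have : has (q.-1).-primitive_root%R (enum (predC1 (0 : 'F_q)%R)).
  apply: has_prim_root => //; last by rewrite -cardE cardC1 card_Fp.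
    apply/allP => x; rewrite mem_enum !inE => nzx.
    by rewrite unity_rootE Fp_expf_pred.
  exact: enum_uniq.
by case/hasP=> w _ prim_w; exists w.
Qed.

Lemma conjg_expn (gT : finGroupType) (x y : gT) (a j : nat) :
  x ^ y = x ^+ a -> x ^ (y ^+ j) = x ^+ (a ^ j).
Proof.
move=> xy; elim: j => [|j IHj]; first by rewrite conjg1.
by rewrite expgSr conjgM IHj conjXg xy -expgM expnSr mulnC.
Qed.

Section NoncyclicGroup.
Variables (gT : finGroupType) (G H : {group gT}) (q r : nat).
Hypotheses (q_pr : prime q) (r_pr : prime r) (neq_rq : r != q).
Hypotheses (nsHG : H <| G) (oH : #|H| = q) (oG : #|G| = (q * r)%N).

Lemma mul_cycles_of_prime_order (x y : gT) :
  x \in G -> y \in G -> #[x] = q -> #[y] = r -> <[x]> * <[y]> = G.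
Proof.
move=> Gx Gy ox oy; apply/eqP; rewrite eqEcard mul_subG ?cycle_subG //=.
have tixy : <[x]> :&: <[y]> = 1.
  by rewrite coprime_TIg // -!orderE ox oy prime_coprime // dvdn_prime2 // eq_sym.
by rewrite TI_cardMg // -!orderE ox oy oG.
Qed.

(** An element [y] of order [r] acts on [H = <[x]>] as a power map with exponent [a]. From
    [y ^+ r = 1] follows [a ^ r = 1] modulo [q]; if [a] were 1 modulo [q], then [x] and [y] would
    commute and, their orders being coprime, [G] would be cyclic. *)
Lemma noncyclic_conj_primitive_root : ~~ cyclic G ->
  exists x y a, [/\ H = <[x]>%G, y \in G, #[y] = r, x ^ y = x ^+ a
    & (r.-primitive_root (a%:R : 'F_q))%R].
Proof.
move=> ncG; have [sHG nHG] := andP nsHG.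
have /cyclicP[x defH] : cyclic H by rewrite prime_cyclic ?oH.
have ox : #[x] = q by rewrite orderE -defH.
have Gx : x \in G by rewrite (subsetP sHG) // defH cycle_id.
have [y Gy oy] : {y | y \in G & #[y] = r}.
  by apply: Cauchy => //; rewrite oG dvdn_mull.
have /cycleP[a xy] : x ^ y \in <[x]>.
  by rewrite -defH memJ_norm ?(subsetP nHG) // defH cycle_id.
exists x, y, a; split=> //; first exact: val_inj.
apply: prime_primitive_root => //.
  rewrite -natrX -[RHS]/(1%:R)%R; apply/eqP; rewrite eq_natr_Fp // -ox.
  by rewrite -eq_expg_mod_order -(conjg_expn _ xy) -oy expg_order conjg1.
apply: contra ncG; rewrite -[1%R]/(1%:R)%R eq_natr_Fp // -ox.
rewrite -eq_expg_mod_order -xy => /eqP/conjg_fixP/commgP cxy.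
rewrite -(mul_cycles_of_prime_order Gx Gy ox oy).
apply: cyclicM; rewrite ?cycle_cyclic -?orderE ?ox ?oy //.
  by rewrite cent_cycle cycle_subG cent1C; apply/cent1P.
by rewrite prime_coprime // dvdn_prime2 // eq_sym.
Qed.

End NoncyclicGroup.

Section Frobenius.
Variables (q r : nat) (w : 'F_q).
Hypotheses (q_pr : prime q) (r_pr : prime r).
Hypothesis prim_w : (r.-primitive_root w)%R.

Let natw : ((w : nat)%:R = w)%R. Proof. exact: natr_Zp. Qed.

Let w_neq1 : w != 1%R.
Proof.
by rewrite -(prim_order_dvd prim_w 1) dvdn1 gtn_eqF ?prime_gt1.
Qed.

Lemma prime_index_dvd_pred : r %| q.-1.
Proof.
rewrite (prim_order_dvd prim_w) Fp_expf_pred //.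
by rewrite (prim_root_eq0 prim_w) gtn_eqF ?prime_gt0.
Qed.

Lemma prime_index_neq : r != q.
Proof.
apply: contraTneq prime_index_dvd_pred => ->.
have q_gt1 := prime_gt1 q_pr; rewrite gtnNdvd //; last by rewrite ltn_predL ltnW.
by rewrite -subn1 subn_gt0.
Qed.

(** The semidirect product of a cyclic group of order [q] by one of order [r], whose generator acts
    as the power map with exponent [w]. *)
Local Notation Grep := (Extremal.gtype q r w).

Lemma Grp_frobenius_gtype :
  [set: Grep] \isog Grp (x : y : x ^+ q, y ^+ r, x ^ y = x ^+ w).
Proof.
have q_gt1 := prime_gt1 q_pr.
pose b : 'Z_q := Zp1.
have ob : #[b] = q by rewrite order_Zp1 Zp_cast.
have ob_gt1 : 1 < #[b] by rewrite ob.
have unitw : ((w : nat)%:R : 'Z_#[b])%R \in GRing.unit.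
  rewrite unitZpE // ob prime_coprime //; apply: contraNN (_ : w != 0%R).
    by rewrite /dvdn -[0%N](mod0n q) -eq_natr_Fp // natw.
  by rewrite (prim_root_eq0 prim_w) gtn_eqF ?prime_gt0.
(* Multiplication by the unit [w] is the required automorphism; its order divides [r] because
   [w ^ r = 1] modulo [q]. *)
pose u := FinRing.unit 'Z_#[b] unitw.
apply: Extremal.Grp => //; first exact: prime_gt1.
exists (Zp_unitm u).
rewrite Aut_aut order_injm ?injm_Zp_unitm ?in_setT //; split=> //.
  rewrite order_dvdn -val_eqE FinRing.val_unitX /= -natrX; apply/eqP/val_inj.
  rewrite /= val_Zp_nat // ob [in RHS]Zp_cast //; apply/eqP.
  by rewrite -eq_natr_Fp // natrX natw (prim_expr_order prim_w).
rewrite autE ?cycle_id //; apply/eqP; rewrite eq_expg_mod_order /= -/b.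
by rewrite val_Zp_nat // modn_mod.
Qed.

Lemma card_frobenius_gtype : #|[set: Grep]| = (q * r)%N.
Proof. by rewrite Extremal.card ?prime_gt1 // mulnC. Qed.

Lemma frobenius_gtype_structure :
  exists2 H : {group Grep}, H <| [set: Grep] &
    #|H| = q /\ ~~ cyclic [set: Grep].
Proof.
have /existsP[[x y] /eqP[defG xq yr xy]] := isoGrp_hom Grp_frobenius_gtype.
have nxG : <[x]> <| [set: Grep].
  by rewrite /normal subsetT -defG join_subG normG norms_cycle xy mem_cycle.
(* The relations only give that [#[x]] divides [q]; if [x] were trivial, [y] alone would generate a
   group of order at most [r < q * r]. *)
have ox : #[x] = q.
  have : #[x] %| q by rewrite order_dvdn xq.
  have /primeP[_ dvd_q] := q_pr => /dvd_q/orP[/eqP ox1|/eqP //].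
  have oy : #[y] <= r by rewrite dvdn_leq ?prime_gt0 // order_dvdn yr.
  move: oy; move/eqP: ox1; rewrite order_eq1 => /eqP x1; rewrite orderE.
  move: defG; rewrite x1 cycle1 joing1G => ->.
  by rewrite card_frobenius_gtype leqNgt ltn_Pmull ?prime_gt1 ?prime_gt0.
exists <[x]>%G => //; split; first by rewrite -orderE.
(* The generators do not commute, since [w] is not 1 modulo [q]. *)
apply/negP => /cyclic_abelian/centsP/(_ x (in_setT _) y (in_setT _)) /commgP/conjg_fixP.
rewrite xy -{2}[x]expg1 => /eqP.
by rewrite eq_expg_mod_order ox -eq_natr_Fp // natw (negPf w_neq1).
Qed.

(** By the presentation and equality of orders, it suffices to find generators of [G] satisfying the
    relations. In particular the isomorphism type does not depend on the choice of the primitive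
    root [w]. *)
Lemma isog_frobenius_gtype (gT : finGroupType) (G H : {group gT}) :
    H <| G -> #|H| = q -> #|G| = (q * r)%N -> ~~ cyclic G ->
  G \isog [set: Grep].
Proof.
move=> nsHG oH oG ncG; have [sHG nHG] := andP nsHG.
apply/(isoGrpP _ Grp_frobenius_gtype); split.
  by rewrite oG card_frobenius_gtype.
have [x [y [a [defH Gy oy xy prim_a]]]] :=
  noncyclic_conj_primitive_root q_pr r_pr prime_index_neq nsHG oH oG ncG.
have ox : #[x] = q by rewrite orderE -oH defH.
have Gx : x \in G by rewrite (subsetP sHG) // defH cycle_id.
have [[k _] /= def_w] := prim_rootP prim_a (prim_expr_order prim_w).
(* Both a and w are primitive r-th roots of 1 modulo q, so a power of y acts
   on x as w does. *)
pose z := y ^+ k.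
have xz : x ^ z = x ^+ w.
  rewrite (conjg_expn _ xy); apply/eqP.
  by rewrite eq_expg_mod_order ox -eq_natr_Fp // natw natrX -def_w.
have oz : #[z] = r.
  apply: nt_prime_order => //.
    by move: (expg_order y); rewrite oy -expgM mulnC expgM => ->; rewrite expg1n.
  apply: contra w_neq1 => /eqP z1; rewrite -natw -[1%R]/(1%:R)%R eq_natr_Fp //.
  by have := eq_expg_mod_order x w 1; rewrite ox => <-; rewrite -xz z1 conjg1 expg1.
have Gz : z \in G by rewrite groupX.
apply/existsP; exists (x, z); rewrite /= !xpair_eqE.
rewrite -{1}ox -{1}oz !expg_order xz !eqxx andbT norm_joinEr; last first.
  by rewrite cycle_subG; have := subsetP nHG z Gz; rewrite defH.
by rewrite (mul_cycles_of_prime_order q_pr r_pr prime_index_neq oG) ?eqxx.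
Qed.

End Frobenius.

(** Groups of order [q ^ 2] are abelian, and an element of order [q ^ 2] would generate [G]. *)
Lemma noncyclic_p2group_abelem (gT : finGroupType) (G : {group gT}) (q : nat) :
  prime q -> #|G| = (q * q)%N -> ~~ cyclic G -> q.-abelem G.
Proof.
move=> q_pr oG ncG; rewrite abelemE //.
rewrite (card_p2group_abelian q_pr) -?mulnn //=.
apply/exponentP => x Gx; apply/eqP; rewrite -order_dvdn.
have [/eqP|x_neq1] := eqVneq #[x] 1%N; first
  by rewrite order_eq1 => /eqP->; rewrite order1.
suff : #[x] \in [:: q; q] by rewrite !inE orbb => /eqP->.
apply: proper_dvdn_mul_primes; rewrite -?oG ?order_dvdG //.
apply: contra ncG => /eqP ox.
suff -> : G = <[x]>%G by apply: cycle_cyclic.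
by apply/esym/val_inj/eqP; rewrite /= eqEcard cycle_subG Gx -ox /= orderE.
Qed.

Lemma abelem_p2group_exists (q : nat) : prime q ->
  exists gT : finGroupType, q.-abelem [set: gT] /\ #|[set: gT]| = (q * q)%N.
Proof.
move=> q_pr; exists 'rV['F_q]_2; split; first exact: fin_Fp_lmod_abelem.
by rewrite cardsT card_mx card_Fp // mul1n mulnn.
Qed.

(** * The isomorphism classes with graph K_(q+1) *)

Section CompleteGraph.
Variable n : nat.

Definition Kn_adj : rel 'I_n := fun x y => x != y.

Fact Kn_adj_sym : symmetric Kn_adj.
Proof. by move=> x y; rewrite /Kn_adj eq_sym. Qed.

Fact Kn_adj_irr : irreflexive Kn_adj.
Proof. by move=> x; rewrite /Kn_adj eqxx. Qed.

Definition Kn : finGraph := FinGraph Kn_adj_sym Kn_adj_irr.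

Lemma graph_iso_KnP (A : finGraph) :
  graph_iso A Kn <-> complete_graph A /\ #|A| = n.
Proof.
split=> [[f f_bij f_adj] | [complA cardA]].
  split=> [x y neq_xy|]; last by rewrite (bij_eq_card f_bij) card_ord.
  by rewrite -f_adj /= /Kn_adj (inj_eq (bij_inj f_bij)).
exists (fun x => cast_ord cardA (enum_rank x) : Kn).
  apply: bij_comp (enum_rank_bij A).
  by exists (cast_ord (esym cardA)); [apply: cast_ordK | apply: cast_ordKV].
move=> x y; rewrite /= /Kn_adj (inj_eq (@cast_ord_inj _ _ _)) (inj_eq enum_rank_inj).
by have [->|/complA->//] := eqVneq x y; rewrite adj_irr.
Qed.

End CompleteGraph.

Lemma coint_graph_iso_Kn (gT : finGroupType) (G H : {group gT}) (q r : nat) :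
    prime q -> prime r -> H <| G -> #|H| = q -> #|G| = (q * r)%N -> ~~ cyclic G ->
  graph_iso (coint_graph G) (Kn q.+1).
Proof.
move=> q_pr r_pr nHG oH; rewrite -oH in q_pr *; move=> oG ncG.
apply/graph_iso_KnP.
have [prG cardG] := card_coint_graph_noncyclic q_pr r_pr nHG oG ncG.
by split=> //; apply/complete_coint_graphP.
Qed.

Lemma abelem_p2group_coint_graph (gT : finGroupType) (G : {group gT}) (q : nat) :
  prime q -> q.-abelem G -> #|G| = (q * q)%N -> graph_iso (coint_graph G) (Kn q.+1).
Proof.
move=> q_pr abelG oG.
have [x Gx ox] : {x | x \in G & #[x] = q} by apply: Cauchy => //; rewrite oG dvdn_mull.
have ncG : ~~ cyclic G by rewrite (abelem_cyclic abelG) oG mulnn pfactorK.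
apply: (@coint_graph_iso_Kn _ _ <[x]>%G q q) => //.
by rewrite -sub_abelian_normal ?cycle_subG // (abelem_abelian abelG).
Qed.

Lemma iso_classes_of_Kn (q : nat) : prime q ->
  iso_classes_of_graph (size (primes q.-1)).+1 (Kn q.+1).
Proof.
move=> q_pr; set rs := primes q.-1.
have q1_gt0 : 0 < q.-1 by rewrite -subn1 subn_gt0 prime_gt1.
have [z prim_z] := Fp_primitive_root_exists q_pr.
have [E [abelE oE]] := abelem_p2group_exists q_pr.
(* For a prime [r] dividing [q - 1], this power of a generator of the unit group is a primitive
   [r]-th root of unity. *)
pose w r : 'F_q := (z ^+ (q.-1 %/ r))%R.
have rsP r : r \in rs -> prime r /\ (r.-primitive_root (w r))%R.
  rewrite mem_primes => /and3P[r_pr _ r_dvd]; split=> //.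
  exact: (dvdn_prim_root prim_z r_dvd).
(* The group of index [i] will have order [q * c i]: index 0 is the elementary abelian group, and
   index [j + 1] belongs to the [j]-th prime divisor of [q - 1]. *)
pose c (i : nat) := if i is j.+1 then nth 0%N rs j else q.
pose F (i : nat) := if i is j.+1 then Extremal.gtype q (c i) (w (c i)) else E.
have c_rs j : j < size rs -> c j.+1 \in rs by apply: mem_nth.
have oF i : i < (size rs).+1 -> #|[set: F i]| = (q * c i)%N.
  case: i => [|j] //; rewrite ltnS => /c_rs/rsP[r_pr _].
  exact: card_frobenius_gtype.
exists (fun i : 'I_(size rs).+1 => F i); split.
- case=> [[|j] /= lt_j]; first exact: abelem_p2group_coint_graph.
  have [r_pr prim_w] := rsP _ (c_rs j lt_j).
  have [H nHG [oH ncG]] := frobenius_gtype_structure q_pr r_pr prim_w.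
  apply: (coint_graph_iso_Kn q_pr r_pr nHG) => //.
  exact: card_frobenius_gtype.
(* The orders alone separate the classes: the primes in [rs] are distinct and, dividing [q - 1],
   differ from [q]. *)
- have neq_c j : j < size rs -> c j.+1 != q.
    by move=> /c_rs/rsP[r_pr]; apply: prime_index_neq.
  move=> i j /card_isog; rewrite !oF // => /eqP.
  rewrite eqn_pmul2l ?prime_gt0 // => /eqP eq_c; apply: val_inj.
  case: i j eq_c => [[|i] lt_i] [[|j] lt_j] //= eq_c.
  + by have := neq_c j lt_j; rewrite /= -eq_c eqxx.
  + by have := neq_c i lt_i; rewrite /= eq_c eqxx.
  by congr _.+1; apply/eqP; rewrite -(nth_uniq 0%N _ _ (primes_uniq q.-1)) //; apply/eqP.
move=> gT /graph_iso_KnP[complG cardG].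
have [|H nHG [H_pr r_pr ncG]] := complete_coint_graph_structure complG.
  by rewrite cardG ltnS prime_gt1.
rewrite cardG => -[/esym oH]; have := Lagrange (normal_sub nHG).
rewrite oH => /esym oG.
(* The normal subgroup has order [q]. Index [q] gives the elementary abelian group; any other prime
   index [r] divides [q - 1], through a primitive [r]-th root of unity in ['F_q]. *)
have [eq_rq | neq_rq] := eqVneq #|[set: gT] : H| q.
  rewrite eq_rq in oG; exists ord0.
  rewrite /group_iso (isog_abelem_card _ (noncyclic_p2group_abelem q_pr oG ncG)).
  by rewrite abelE oE oG eqxx.
set r := #|_ : H| in r_pr oG neq_rq.
have r_rs : r \in rs.
  have [x [y [a [_ _ _ _ prim_a]]]] :=
    noncyclic_conj_primitive_root q_pr r_pr neq_rq nHG oH oG ncG.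
  by rewrite mem_primes r_pr q1_gt0 (prime_index_dvd_pred q_pr r_pr prim_a).
have [_ prim_w] := rsP r r_rs.
have lt_r : index r rs < size rs by rewrite index_mem.
exists (Ordinal (lt_r : (index r rs).+1 < (size rs).+1)).
rewrite /group_iso /= nth_index //.
exact: (isog_frobenius_gtype q_pr r_pr prim_w nHG).
Qed.

(* Infinitely many class numbers *)
From mathcomp Require Import classical_sets cardinality.

Theorem proposition1p7 :
  infinite_set [set k : nat | (0 < k)%N /\
     exists Gamma : finGraph, iso_classes_of_graph k Gamma]%classic
  /\
  infinite_set [set k : nat | (0 < k)%N /\
     exists Gamma : finGraph,
       complete_graph Gamma /\ iso_classes_of_graph k Gamma]%classic.
Proof.
set A := [set k : nat | _]%classic; set B := [set k : nat | _]%classic.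
suff infB : infinite_set B.
  split=> // finA; apply: infB; apply: sub_finite_set finA.
  by move=> k [k_gt0 [Gamma [_ isoG]]]; split=> //; exists Gamma.
move=> /finite_seqP[s defB].
(* If [B] were finite with elements [s], some prime [q] would have at least [max s] prime divisors
   of [q - 1], and the extra class makes [k] exceed that maximum. *)
have [q q_pr many] := ex_prime_pred_many_primes (\max_(k <- s) k).
set k := (size (primes q.-1)).+1.
have : B k.
  split=> //; exists (Kn q.+1).
  by split=> [x y|]; last exact: iso_classes_of_Kn.
rewrite defB /= => s_k; have := @leq_bigmax_seq _ s xpredT id k s_k isT.
by rewrite /= leqNgt ltnS many.
Qed.
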